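(* Let $n,m,l$ be positive integers with $n\le m<l$, and let $k'$ be the positive integer with $k'm<l\le(k'+1)m$. Let $A\in\mathcal{T}(n,m)$, $A\ne0$, be $A=A(a,\alpha)+a_0I_{n\times m}$ and let $B\in\mathcal{T}(m,l)$, $B\neq0$, be $B=A(b,\beta)+b_0I_{m\times l}$, where $a=(0,a_1,\dots,a_{n-1})^T$, $\alpha=(0,\alpha_1,\dots,\alpha_{m-1})^T$, $b=(0,b_1,\dots,b_{m-1})^T$, $\beta=(0,\beta_1,\dots,\beta_{l-1})^T$. Then $AB\in\mathcal{T}(n,l)$ if and only if at least one of the following conditions holds: (1) $A$ is the asymmetric Toeplitz matrix with first column $(a_0,0,\dots,0)^T$ and first row $(a_0,\overline{\alpha}_1,\dots,\overline{\alpha}_{m-n},0,\dots,0)$ (that is, $a=0$ and $\alpha_j=0$ for $m-n+1\le j\le m-1$). (2) There is $\lambda\in\hat{\mathbb{C}}=\mathbb{C}\cup\{\infty\}$ such that $A=A(\lambda\hat{\alpha}_{(m,n)},\alpha)+a_0I_{n\times m}$ and $B$ has form $(\mathrm{b}_\lambda)$, with the following meaning. For $\lambda\in\mathbb{C}\setminus\{0\}$: $a=\lambda\hat{\alpha}_{(m,n)}$, and $(\mathrm{b}_\lambda)$ says that $B$ is the asymmetric Toeplitz matrix with first column $(b_0,\lambda\overline{\beta}_{m-1},\dots,\lambda\overline{\beta}_1)^T$ and first row $(b_0,\overline{\beta}_1,\dots,\overline{\beta}_{m-1},\tfrac1\lambda b_0,\tfrac1\lambda\overline{\beta}_1,\dots,\tfrac1\lambda\overline{\beta}_{m-1},\dots,\tfrac1{\lambda^{k'}}b_0,\dots,\tfrac1{\lambda^{k'}}\overline{\beta}_{l-k'm-1})$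 (the last entry being $\tfrac{1}{\lambda^{k'}}b_0$ if $l=k'm+1$). For $\lambda=0$: $a=0$ (so $A=A(0,\alpha)+a_0I_{n\times m}$), and $B$ has first column $0$ and first row $(0,\dots,0,\overline{\beta}_{l-m},\dots,\overline{\beta}_{l-1})$, i.e. $b_0=0$, $b=0$ and $\beta_j=0$ for $1\le j\le l-m-1$. For $\lambda=\infty$: $\hat{\alpha}_{(m,n)}=0$ with $a$ unrestricted (so $A$ has first column $(a_0,a_1,\dots,a_{n-1})^T$ and first row $(a_0,\overline{\alpha}_1,\dots,\overline{\alpha}_{m-n},0,\dots,0)$), and $B=A(b,0)+b_0I_{m\times l}$, i.e. $\beta=0$.
   Context: Matrices are complex; rows and columns of an $n\times m$ matrix are numbered $0,\dots,n-1$ and $0,\dots,m-1$. An asymmetric Toeplitz matrix is an $n\times m$ matrix constant along each diagonal (hence determined by its first row and first column); $\mathcal{T}(n,m)$ is the set of all of them. For $a=(0,a_1,\dots,a_{n-1})^T\in\mathbb{C}^n$ and $\alpha=(0,\alpha_1,\dots,\alpha_{m-1})^T\in\mathbb{C}^m$, $A(a,\alpha)$ is the $n\times m$ matrix whose $(i,j)$ entry is $a_{i-j}$ if $i>j$, $0$ if $i=j$, and $\overline{\alpha}_{j-i}$ if $i<j$. $I_{n\times m}$ is the $n\times m$ matrix with $(i,j)$ entry $1$ if $i=j$ and $0$ otherwise. Every $A\in\mathcal{T}(n,m)$ is uniquely $A=A(a,\alpha)+a_0I_{n\times m}$ with $a_0\in\mathbb{C}$. For $n\le m$ put $\hat{\alpha}_{(m,n)}=(0,\overline{\alpha}_{m-1},\dots,\overline{\alpha}_{m-n+1})^T\in\mathbb{C}^n$.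 *)

(* Defs.v *)
From HB Require Import structures.
From mathcomp Require Import all_boot all_order all_algebra.
From mathcomp Require Export complex reals.

Set Implicit Arguments.
Unset Strict Implicit.
Unset Printing Implicit Defensive.

Import Order.TTheory GRing.Theory Num.Theory.
Local Open Scope ring_scope.

(* T(n, m) *)
Definition toeplitz (C : Type) (n m : nat) (A : 'M[C]_(n, m)) : Prop :=
  forall (i i' : 'I_n) (j j' : 'I_m), (i + j' = i' + j)%N -> A i j = A i' j'.

(* First column c and first row r, both starting with the corner entry. *)
Definition toeplitz_mx (C : nmodType) (n m : nat) (c r : seq C) :
    'M[C]_(n, m) :=
  \matrix_(i < n, j < m) if (j <= i)%N then c`_(i - j) else r`_(j - i).

(* The k-th coordinate of v, with a natural number as index; the value 0 for
   k >= n is never relevant below. *)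
Definition vcoord (C : nmodType) (n : nat) (v : 'cV[C]_n) (k : nat) : C :=
  if insub k is Some i then v i ord0 else 0.

Section ToeplitzProduct.
Variable C : numClosedFieldType.

(* A(a, alpha) *)
Definition Amx (n m : nat) (a : 'cV[C]_n) (alpha : 'cV[C]_m) : 'M[C]_(n, m) :=
  \matrix_(i < n, j < m)
    if (j < i)%N then vcoord a (i - j)
    else if (i < j)%N then (vcoord alpha (j - i))^* else 0.

(* I_{n x m} *)
Definition Imx (n m : nat) : 'M[C]_(n, m) :=
  \matrix_(i < n, j < m) (i == j :> nat)%:R.

(* \hat alpha_{(m, n)}, meant for n <= m *)
Definition hatv (m n : nat) (alpha : 'cV[C]_m) : 'cV[C]_n :=
  \col_(i < n) if i == 0%N :> nat then 0 else (vcoord alpha (m - i))^*.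

Definition cond1 (n m : nat) (A : 'M[C]_(n, m)) (alpha : 'cV[C]_m) (a0 : C) :
    Prop :=
  A = toeplitz_mx n m
        (a0 :: nseq n.-1 0)
        (a0 :: [seq (vcoord alpha j)^* | j <- iota 1 (m - n)] ++ nseq n.-1 0).

(* The point at infinity of the extended complex plane is None. *)
Definition hatC : Type := option C.

(* A = A(lambda \hat alpha, alpha) + a0 I; for lambda = oo, this means that
   \hat alpha = 0, with no restriction on a. *)
Definition A_form (n m : nat) (A : 'M[C]_(n, m)) (alpha : 'cV[C]_m) (a0 : C)
    (lambda : hatC) : Prop :=
  if lambda is Some z then
    A = Amx (z *: hatv n alpha) alpha + a0 *: Imx n m
  else hatv n alpha = 0.

(* (b_lambda); [seq E | q <- s, x <- t] lists the block q = 0 first, and in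
   each block x follows the order of t. *)
Definition B_form (m l k : nat) (B : 'M[C]_(m, l))
    (b : 'cV[C]_m) (beta : 'cV[C]_l) (b0 : C) (lambda : hatC) : Prop :=
  if lambda is Some z then
    if z == 0 then
      B = toeplitz_mx m l
            (nseq m 0)
            (nseq (l - m) 0 ++ [seq (vcoord beta j)^* | j <- iota (l - m) m])
    else
      B = toeplitz_mx m l
            (b0 :: [seq z * (vcoord beta (m - i))^* | i <- iota 1 m.-1])
            (take l [seq z ^- q * x
                    | q <- iota 0 k.+1,
                      x <- b0 :: [seq (vcoord beta r)^* | r <- iota 1 m.-1]])
  else B = Amx b 0 + b0 *: Imx m l.

End ToeplitzProduct.

(* Main.v *)
Require Import Defs.
From HB Require Import structures.
From mathcomp Require Import all_boot all_order all_algebra.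
From mathcomp Require Import complex reals.
From mathcomp Require Import zify.

Set Implicit Arguments.
Unset Strict Implicit.
Unset Printing Implicit Defensive.

Import Order.TTheory GRing.Theory Num.Theory.
Local Open Scope ring_scope.

(** Write the entries of the two Toeplitz matrices as [A i j = s (j - i)] and
    [B j k = t (k - j)], for functions [s], [t] on the integers.  Then
    [(A B) (i + 1) (k + 1)] and [(A B) i k] are sums of the same products,
    except for one term at each end, so that [A B] is Toeplitz if and only if
    [s (- i) t k = s (m - i) t (k - m)] for [0 < i < n] and [0 < k < l]
    ([toeplitz_mulP]).  This is an equality [u p^T = v q^T] of matrices of rank
    at most one, with [u = (a_i)], [v] the vector [\hat alpha], [p] the tail of
    the first row of [B], and [q] the sequence [t (1 - m), ..., t (l - 1 - m)].
    Every diagonal of [B] occurs in [p] or in [q], hence [p] and [q] are not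
    both zero.  So either [u = v = 0], which is the first condition, or the two
    pairs are proportional with a common ratio: [u = lambda v] and
    [q = lambda p], or [v = 0] and [p = 0] when [lambda] is infinite
    ([rank1_eqP]).  Finally, [q = lambda p] is the recurrence
    [t (k - m) = lambda t k]; unfolding it gives the first row and column that
    define the form [(b_lambda)] ([B_form_finP]). *)

(** * Toeplitz matrices given by a function on the diagonals *)

(** The matrix whose entry on the diagonal [j - i = d] is [s d]; only the
    values of [s] at [- n < d < m] matter. *)
Definition diag_fun_mx (C : Type) (n m : nat) (s : int -> C) : 'M[C]_(n, m) :=
  \matrix_(i < n, j < m) s (j%:Z - i%:Z).

Lemma eq_diag_fun_mx (C : Type) (n m : nat) (s t : int -> C) :
    (0 < n)%N -> (0 < m)%N ->
  diag_fun_mx n m s = diag_fun_mx n m t <->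
  (forall i, (i < n)%N -> s (- i%:Z) = t (- i%:Z)) /\
  (forall j, (0 < j < m)%N -> s j%:Z = t j%:Z).
Proof.
move=> n0 m0; split=> [/matrixP E | [Ec Er]].
  split=> [i ltin | j /andP[_ ltjm]].
    by have := E (Ordinal ltin) (Ordinal m0); rewrite !mxE /= sub0r.
  by have := E (Ordinal n0) (Ordinal ltjm); rewrite !mxE /= subr0.
apply/matrixP=> i j; rewrite !mxE.
have [leji | ltij] := leqP j i.
  have -> : j%:Z - i%:Z = - (i - j)%N%:Z by lia.
  by apply: Ec; have := ltn_ord i; lia.
have -> : j%:Z - i%:Z = (j - i)%N%:Z by lia.
by apply: Er; have := ltn_ord j; lia.
Qed.

(** Being Toeplitz only needs to be checked on diagonally adjacent entries. *)
Lemma toeplitz_nextP (C : Type) (n m : nat) (M : nat -> nat -> C) :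
  toeplitz (\matrix_(i < n, j < m) M i j) <->
  (forall i j, (i.+1 < n)%N -> (j.+1 < m)%N -> M i j = M i.+1 j.+1).
Proof.
split=> [T i j lti ltj | N].
  have := T (Ordinal (ltnW lti)) (Ordinal lti)
            (Ordinal (ltnW ltj)) (Ordinal ltj).
  by rewrite !mxE /= addnS addSn; apply.
have shift d : forall i j, (i + d < n)%N -> (j + d < m)%N ->
    M i j = M (i + d)%N (j + d)%N.
  elim: d => [|d IHd] i j lti ltj; first by rewrite !addn0.
  by rewrite !addnS in lti ltj *; rewrite -N // -IHd // ltnW.
move=> i i' j j' E; rewrite !mxE.
have [lei | lti] := leqP i i'.
  have -> : i' = (i + (i' - i))%N :> nat by lia.
  have -> : j' = (j + (i' - i))%N :> nat by lia.
  by apply: shift; have := (ltn_ord i', ltn_ord j'); case; lia.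
have -> : i = (i' + (i - i'))%N :> nat by lia.
have -> : j = (j' + (i - i'))%N :> nat by lia.
by symmetry; apply: shift; have := (ltn_ord i, ltn_ord j); case; lia.
Qed.

Lemma toeplitz_mulP (C : pzRingType) (n m l : nat) (s t : int -> C) :
  toeplitz (diag_fun_mx n m s *m diag_fun_mx m l t) <->
  (forall (i : 'I_n) (k : 'I_l), (0 < i)%N -> (0 < k)%N ->
     s (- i%:Z) * t k%:Z = s (m%:Z - i%:Z) * t (k%:Z - m%:Z)).
Proof.
pose M i k := \sum_(j < m) s (j%:Z - i%:Z) * t (k%:Z - j%:Z).
have -> : diag_fun_mx n m s *m diag_fun_mx m l t =
          \matrix_(i < n, k < l) M i k.
  by apply/matrixP=> i k; rewrite !mxE; apply: eq_bigr => j _; rewrite !mxE.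
have shiftM i k : s (- i.+1%:Z) * t k.+1%:Z + M i k =
    M i.+1 k.+1 + s (m%:Z - i.+1%:Z) * t (k.+1%:Z - m%:Z).
  (* both sides are the sum over 0 <= j <= m of the terms of M (i+1) (k+1) *)
  pose G (j : nat) := s (j%:Z - i.+1%:Z) * t (k.+1%:Z - j%:Z).
  transitivity (\sum_(j < m.+1) G j); last by rewrite big_ord_recr.
  rewrite big_ord_recl /G /= sub0r subr0; congr (_ + _).
  apply: eq_bigr => j _; congr (s _ * t _); rewrite /= /bump /=; lia.
apply: (iff_trans (toeplitz_nextP _ _ _)).
split=> [E [[|i] lti] [[|k] ltk] //= _ _ | E i k lti ltk].
  by have := shiftM i k; rewrite E // addrC => /addrI.
have /= Eik := E (Ordinal lti) (Ordinal ltk) isT isT.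
by have := shiftM i k; rewrite Eik addrC => /addIr.
Qed.

(** * Equality of two matrices of rank at most one *)

(** The pairs [(u, v)] and [(q, p)] are proportional to [(lambda, 1)], with the
    convention that [None] stands for the ratio [1 / 0]. *)
Definition in_ratio (F : fieldType) (I K : Type) (P : pred I) (Q : pred K)
    (u v : I -> F) (p q : K -> F) (lambda : option F) : Prop :=
  if lambda is Some z then
    (forall i, P i -> u i = z * v i) /\ (forall k, Q k -> q k = z * p k)
  else (forall i, P i -> v i = 0) /\ (forall k, Q k -> p k = 0).

(** The left-hand side is the equality of [u p^T] and [v q^T].  Only [p] and [q]
    are assumed not to vanish together, so the case [u = v = 0] has to be kept
    apart. *)
Lemma rank1_eqP (F : fieldType) (I K : finType) (P : pred I) (Q : pred K)
    (u v : I -> F) (p q : K -> F) :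
    ~ (forall k, Q k -> p k = 0 /\ q k = 0) ->
  (forall i k, P i -> Q k -> u i * p k = v i * q k) <->
  (forall i, P i -> u i = 0 /\ v i = 0) \/
  exists lambda, in_ratio P Q u v p q lambda.
Proof.
move=> pq_neq0; split; last first.
  case=> [uv0 i k Pi _ | [[z|] [E1 E2]] i k Pi Qk].
  - by have [-> ->] := uv0 i Pi; rewrite !mul0r.
  - by rewrite E1 // E2 // mulrA (mulrC z).
  - by rewrite E1 // E2 // mulr0 mul0r.
move=> E; case: (pickP (fun i => P i && (v i != 0))) => [i0 | v0].
  case/andP=> Pi0 vi0; right; exists (Some (u i0 / v i0)).
  have Eq k : Q k -> q k = u i0 / v i0 * p k.
    by move=> Qk; rewrite mulrAC E // mulrC mulKf.
  split=> // i Pi.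
  case: (pickP (fun k => Q k && (p k != 0))) => [k0 /andP[Qk0 pk0] | p0].
    by apply: (mulIf pk0); rewrite E // Eq // mulrCA mulrA.
  case: pq_neq0 => k Qk; have := p0 k; rewrite Qk /= => /negbFE/eqP pk.
  by rewrite Eq // pk mulr0.
have {}v0 i : P i -> v i = 0.
  by move=> Pi; have := v0 i; rewrite Pi => /negbFE/eqP.
case: (pickP (fun i => P i && (u i != 0))) => [i0 /andP[Pi0 ui0] | u0].
  right; exists None; split=> // k Qk.
  by apply: (mulfI ui0); rewrite E // v0 // mul0r mulr0.
left=> i Pi; split; last exact: v0.
by have := u0 i; rewrite Pi => /negbFE/eqP.
Qed.

(** * The diagonals of [A(a, alpha) + a0 I] *)

Lemma vcoord_col (C : nmodType) (n : nat) (E : nat -> C) (k : nat) :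
  (k < n)%N -> vcoord (\col_(i < n) E i) k = E k.
Proof. by move=> ltkn; rewrite /vcoord insubT mxE. Qed.

Lemma vcoordZ (C : pzRingType) (n : nat) (z : C) (v : 'cV[C]_n) (k : nat) :
  vcoord (z *: v) k = z * vcoord v k.
Proof. by rewrite /vcoord; case: insubP => [i _ _|_]; rewrite ?mxE ?mulr0. Qed.

Lemma vcoord0 (C : nmodType) (n : nat) (k : nat) :
  vcoord (0 : 'cV[C]_n) k = 0.
Proof. by rewrite /vcoord; case: insubP => // i _ _; rewrite mxE. Qed.

Section Diagonals.
Variable C : numClosedFieldType.
Implicit Types (n m l : nat).

(** The values of [A(a, alpha) + a0 I] on its diagonals: [Adiag a alpha a0 d] is
    the entry at each [(i, j)] with [j - i = d].  The main diagonal only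
    depends on [a0], so the coordinates of index 0 of [a] and [alpha] are not
    used. *)
Definition Adiag n m (a : 'cV[C]_n) (alpha : 'cV[C]_m) (a0 : C) (d : int) : C :=
  match d with
  | Posz 0 => a0
  | Posz k => (vcoord alpha k)^*
  | Negz k => vcoord a k.+1
  end.

Lemma Adiag_neg n m (a : 'cV[C]_n) (alpha : 'cV[C]_m) a0 i :
  (0 < i)%N -> Adiag a alpha a0 (- i%:Z) = vcoord a i.
Proof. by case: i. Qed.

Lemma Adiag_pos n m (a : 'cV[C]_n) (alpha : 'cV[C]_m) a0 j :
  (0 < j)%N -> Adiag a alpha a0 j%:Z = (vcoord alpha j)^*.
Proof. by case: j. Qed.

Lemma Adiag_mx n m (a : 'cV[C]_n) (alpha : 'cV[C]_m) a0 :
  Amx a alpha + a0 *: Imx C n m = diag_fun_mx n m (Adiag a alpha a0).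
Proof.
apply/matrixP=> i j; rewrite !mxE.
have [ltji | ltij | ->] := ltngtP j i.
- have -> : j%:Z - i%:Z = - (i - j)%N%:Z by lia.
  by rewrite mulr0 addr0 Adiag_neg // subn_gt0.
- have -> : j%:Z - i%:Z = (j - i)%N%:Z by lia.
  by rewrite mulr0 addr0 Adiag_pos // subn_gt0.
- by rewrite subrr add0r mulr1.
Qed.

Lemma toeplitz_mx_diag n m (c r : seq C) :
  toeplitz_mx n m c r =
  diag_fun_mx n m (fun d => if d <= 0 then c`_`|d|%N else r`_`|d|%N).
Proof.
apply/matrixP=> i j; rewrite !mxE.
have [leji | ltij] := leqP j i.
  rewrite ifT; last by lia.
  by congr (c`_ _); lia.
rewrite ifF; last by lia.
by congr (r`_ _); lia.
Qed.

(** A diagonal function gives the Toeplitz matrix with prescribed first column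
    and first row exactly when it matches them entry by entry. *)
Lemma diag_fun_toeplitz_mx n m (s : int -> C) (c r : seq C) :
    (0 < n)%N -> (0 < m)%N ->
  diag_fun_mx n m s = toeplitz_mx n m c r <->
  (forall i, (i < n)%N -> s (- i%:Z) = c`_i) /\
  (forall j, (0 < j < m)%N -> s j%:Z = r`_j).
Proof.
move=> n0 m0; rewrite toeplitz_mx_diag.
apply: (iff_trans (eq_diag_fun_mx _ _ n0 m0)).
split=> -[Ec Er]; split=> [i lti | j ltj].
- by rewrite Ec // oppr_le0 abszN.
- by rewrite Er //; case: j ltj.
- by rewrite Ec // oppr_le0 abszN.
- by rewrite Er //; case: j ltj.
Qed.

(** * The conditions on [A] and [B] in terms of diagonals *)

Lemma nth_conj_iota m (v : 'cV[C]_m) p k d : (d < k)%N ->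
  [seq (vcoord v j)^* | j <- iota p k]`_d = (vcoord v (p + d))^*.
Proof. by move=> ltdk; rewrite (nth_map 0%N) ?size_iota // nth_iota. Qed.

Section FactorA.
Variables (n m : nat) (a : 'cV[C]_n) (alpha : 'cV[C]_m) (a0 : C).
Hypotheses (n_gt0 : (0 < n)%N) (le_nm : (n <= m)%N).

Let s := Adiag a alpha a0.
Let A := Amx a alpha + a0 *: Imx C n m.

Lemma vcoord_hatv i : (0 < i < n)%N ->
  vcoord (hatv n alpha) i = s (m%:Z - i%:Z).
Proof.
move=> /andP[i0 ltin].
pose E i : C := if i == 0%N then 0 else (vcoord alpha (m - i))^*.
rewrite (vcoord_col E) // /E gtn_eqF //.
have -> : m%:Z - i%:Z = (m - i)%N%:Z by lia.
by rewrite /s Adiag_pos //; lia.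
Qed.

Lemma cond1P : cond1 A alpha a0 <->
  (forall i : 'I_n, (0 < i)%N -> s (- i%:Z) = 0 /\ s (m%:Z - i%:Z) = 0).
Proof.
have m_gt0 : (0 < m)%N by lia.
rewrite /cond1 /A Adiag_mx -/s.
apply: (iff_trans (diag_fun_toeplitz_mx _ _ _ n_gt0 m_gt0)).
split=> [[Ec Er] i i0 | E].
  have lti := ltn_ord i; split.
    by rewrite Ec //; case: (i : nat) i0 => //= k _; rewrite nth_nseq if_same.
  have -> : m%:Z - i%:Z = (m - i).-1.+1%:Z by lia.
  rewrite Er; last by lia.
  rewrite /= nth_cat size_map size_iota ifF; last by lia.
  by rewrite nth_nseq if_same.
split=> [[|i] lti | [|j] //= ltj].
- by [].
- by rewrite (proj1 (E (Ordinal lti) isT)) /= nth_nseq if_same.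
rewrite nth_cat size_map size_iota; case: ltnP => lejmn.
  by rewrite nth_conj_iota.
have lti : (m - j.+1 < n)%N by lia.
have i0 : (0 < m - j.+1)%N by lia.
have [_] := E (Ordinal lti) i0.
have -> : m%:Z - (Ordinal lti)%:Z = j.+1%:Z by rewrite /=; lia.
by rewrite nth_nseq if_same.
Qed.

Lemma A_form_finP z : A_form A alpha a0 (Some z) <->
  (forall i : 'I_n, (0 < i)%N -> s (- i%:Z) = z * s (m%:Z - i%:Z)).
Proof.
have m_gt0 : (0 < m)%N by lia.
rewrite /A_form /A !Adiag_mx -/s.
apply: (iff_trans (eq_diag_fun_mx _ _ n_gt0 m_gt0)).
split=> [[Ec _] i i0 | E].
  by rewrite Ec // Adiag_neg // vcoordZ vcoord_hatv // i0 /=.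
split=> [i lti | j /andP[j0 _]]; last by rewrite /s !Adiag_pos.
case: (posnP i) => [-> // | i0].
by rewrite (E (Ordinal lti)) // Adiag_neg // vcoordZ vcoord_hatv // i0.
Qed.

Lemma A_form_infP : A_form A alpha a0 None <->
  (forall i : 'I_n, (0 < i)%N -> s (m%:Z - i%:Z) = 0).
Proof.
split=> [/= E i i0 | E].
  by rewrite -vcoord_hatv ?i0 ?ltn_ord // E vcoord0.
apply/matrixP=> i j; rewrite mxE [RHS]mxE.
case: eqP => [//|/eqP]; rewrite -lt0n => i0.
rewrite -(E i) // -vcoord_hatv ?i0 ?ltn_ord //.
pose E' i : C := if i == 0%N then 0 else (vcoord alpha (m - i))^*.
by rewrite (vcoord_col E') ?ltn_ord // /E' gtn_eqF.
Qed.

End FactorA.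

(** The block index and the position in the block of the [d]-th entry are the
    quotient and the remainder of [d] by the length of the blocks. *)
Lemma nth_allpairs_iota (f : nat -> C -> C) (p k d : nat) (t : seq C) :
    (d < k * size t)%N ->
  [seq f q x | q <- iota p k, x <- t]`_d =
  f (p + d %/ size t)%N t`_(d %% size t).
Proof.
elim: k p d => [|k IHk] p d //; rewrite mulSn /= nth_cat size_map => ltdk.
case: ltnP => [ltd | led].
  by rewrite (nth_map 0) // divn_small // modn_small // addn0.
have t0 : (0 < size t)%N by case: (size t) ltdk; lia.
rewrite IHk; last by lia.
rewrite -[d in RHS](subnK led) divnDr ?dvdnn // divnn t0 modnDr.
by congr (f _ _); lia.
Qed.

Section FactorB.
Variables (m l k : nat) (b : 'cV[C]_m) (beta : 'cV[C]_l) (b0 : C).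
Hypotheses (m_gt0 : (0 < m)%N) (lt_ml : (m < l)%N).

Let t := Adiag b beta b0.
Let B := Amx b beta + b0 *: Imx C m l.

(** Since [m < l], the offsets [j] and [j - m] with [0 < j < l] cover all the
    diagonals of [B]. *)
Lemma diagonals_neq0 : B != 0 ->
  ~ (forall j : 'I_l, (0 < j)%N -> t j%:Z = 0 /\ t (j%:Z - m%:Z) = 0).
Proof.
move=> /eqP B0 E; apply: B0; rewrite /B Adiag_mx -/t.
apply/matrixP=> i j; rewrite !mxE; have [lti ltj] := (ltn_ord i, ltn_ord j).
have [leji | ltij] := leqP j i.
  have ltl : (m + j - i < l)%N by lia.
  have [|_] := E (Ordinal ltl); first by rewrite /=; lia.
  by move=> <-; congr (t _); rewrite /=; lia.
have ltl : (j - i < l)%N by lia.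
have [|<- _] := E (Ordinal ltl); first by rewrite /=; lia.
by congr (t _); rewrite /=; lia.
Qed.

Lemma B_form_infP : B_form k B b beta b0 None <->
  (forall j : 'I_l, (0 < j)%N -> t j%:Z = 0).
Proof.
have l_gt0 : (0 < l)%N by lia.
rewrite /B_form /B !Adiag_mx -/t.
apply: (iff_trans (eq_diag_fun_mx _ _ m_gt0 l_gt0)).
split=> [[_ Er] j j0 | E].
  by rewrite Er ?j0 ?ltn_ord // Adiag_pos // vcoord0 conjC0.
split=> [[|i] // lti | j /andP[j0 ltj]].
by rewrite (E (Ordinal ltj)) // Adiag_pos // vcoord0 conjC0.
Qed.

Lemma B_form_0P : B_form k B b beta b0 (Some 0) <->
  (forall j : 'I_l, (0 < j)%N -> t (j%:Z - m%:Z) = 0).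
Proof.
have l_gt0 : (0 < l)%N by lia.
rewrite /B_form eqxx /B Adiag_mx -/t.
apply: (iff_trans (diag_fun_toeplitz_mx _ _ _ m_gt0 l_gt0)).
split=> [[Ec Er] j j0 | E].
  have ltj := ltn_ord j; have [lejm | ltmj] := leqP j m.
    have -> : j%:Z - m%:Z = - (m - j)%N%:Z by lia.
    by rewrite Ec ?nth_nseq ?if_same //; lia.
  have -> : j%:Z - m%:Z = (j - m)%N%:Z by lia.
  rewrite Er; last by lia.
  by rewrite nth_cat size_nseq nth_nseq if_same ifT //; lia.
split=> [i lti | j ltj].
  have ltl : (m - i < l)%N by lia.
  have := E (Ordinal ltl); rewrite nth_nseq if_same /=.
  have -> : (m - i)%N%:Z - m%:Z = - i%:Z by lia.
  by apply; lia.
rewrite nth_cat size_nseq nth_nseq if_same; case: ltnP => lejl.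
  have ltl : (j + m < l)%N by lia.
  have := E (Ordinal ltl) => /=.
  have -> : (j + m)%N%:Z - m%:Z = j%:Z by lia.
  by apply; lia.
rewrite nth_conj_iota ?subnKC //; last by lia.
by rewrite /t Adiag_pos //; lia.
Qed.

Hypothesis le_lk : (l <= k.+1 * m)%N.

(** For nonzero [z], the form [(b_z)] solves the recurrence
    [t (j - m) = z t j] in terms of [t 0, ..., t (m - 1)]: the negative
    diagonals are [t (- i) = z t (m - i)], and the others are
    [t (q m + r) = z ^- q t r] with [r < m]. *)
Lemma B_form_unitP z : z != 0 -> B_form k B b beta b0 (Some z) <->
  (forall j : 'I_l, (0 < j)%N -> t (j%:Z - m%:Z) = z * t j%:Z).
Proof.
move=> z0; have l_gt0 : (0 < l)%N by lia.
rewrite /B_form (negPf z0) /B Adiag_mx -/t.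
set c := (X in toeplitz_mx m l X _); set r := take _ _.
have c_nth i : (0 < i < m)%N -> c`_i = z * t (m - i)%N%:Z.
  case: i => // i /andP[_ lti]; rewrite /t Adiag_pos ?subn_gt0 // /c /=.
  have lti' : (i < m.-1)%N by lia.
  by rewrite (nth_map 0%N) ?size_iota // nth_iota.
have r_nth j : (j < l)%N -> r`_j = z ^- (j %/ m) * t (j %% m)%N%:Z.
  move=> ltj; rewrite /r nth_take //.
  set blk := b0 :: _.
  have size_blk : size blk = m by rewrite /= size_map size_iota prednK.
  rewrite nth_allpairs_iota size_blk ?add0n; last by apply: leq_trans le_lk.
  congr (_ * _); have := ltn_pmod j m_gt0.
  case: (j %% m)%N => [|d] ltd //.
  by rewrite /blk /= nth_conj_iota ?add1n //; lia.
apply: (iff_trans (diag_fun_toeplitz_mx _ _ _ m_gt0 l_gt0)).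
split=> [[Ec Er] j j0 | E].
  have Et d : (d < l)%N -> t d%:Z = z ^- (d %/ m) * t (d %% m)%N%:Z.
    case: d => [|d] ltd; first by rewrite div0n mod0n expr0 invr1 mul1r.
    by rewrite Er // r_nth.
  have ltj := ltn_ord j; have [ltjm | lemj] := ltnP j m.
    have -> : j%:Z - m%:Z = - (m - j)%N%:Z by lia.
    rewrite Ec; last by lia.
    by rewrite c_nth; [congr (z * t _); lia | lia].
  have -> : j%:Z - m%:Z = (j - m)%N%:Z by lia.
  rewrite Et; last by lia.
  rewrite (Et j) // -[in RHS](subnK lemj) divnDr ?dvdnn // divnn m_gt0 modnDr.
  by rewrite addn1 exprS invfM mulrA mulVKf.
split=> [i lti | j /andP[_ ltj]].
  case: (posnP i) => [-> // | i0]; rewrite c_nth ?i0 //.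
  have ltl : (m - i < l)%N by lia.
  rewrite -(E (Ordinal ltl)) /=; last by lia.
  by congr (t _); lia.
rewrite r_nth //; elim/ltn_ind: j ltj => j IHj ltj.
have [ltjm | lemj] := ltnP j m.
  by rewrite divn_small // modn_small // expr0 invr1 mul1r.
apply: (mulfI z0); rewrite -(E (Ordinal ltj)) /=; last by lia.
have -> : j%:Z - m%:Z = (j - m)%N%:Z by lia.
rewrite IHj; [ | lia | lia].
rewrite -[j in RHS](subnK lemj) divnDr ?dvdnn // divnn m_gt0 modnDr.
by rewrite addn1 exprS invfM mulrA mulVKf.
Qed.

Lemma B_form_finP z : B_form k B b beta b0 (Some z) <->
  (forall j : 'I_l, (0 < j)%N -> t (j%:Z - m%:Z) = z * t j%:Z).
Proof.
have [-> | z0] := eqVneq z 0; last exact: B_form_unitP.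
apply: (iff_trans B_form_0P).
by split=> E j j0; rewrite E // mul0r.
Qed.

End FactorB.

End Diagonals.

Theorem theorem3p5 (R : realType) (n m l k' : nat)
    (n_gt0 : (0 < n)%N) (m_gt0 : (0 < m)%N) (l_gt0 : (0 < l)%N)
    (le_nm : (n <= m)%N) (lt_ml : (m < l)%N)
    (k'_gt0 : (0 < k')%N) (lt_k'l : (k' * m < l)%N)
    (le_lk' : (l <= (k' + 1) * m)%N)
    (A : 'M[R[i]]_(n, m)) (B : 'M[R[i]]_(m, l))
    (a : 'cV[R[i]]_n) (alpha : 'cV[R[i]]_m) (a0 : R[i])
    (b : 'cV[R[i]]_m) (beta : 'cV[R[i]]_l) (b0 : R[i])
    (a_0 : vcoord a 0 = 0) (alpha_0 : vcoord alpha 0 = 0)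
    (b_0 : vcoord b 0 = 0) (beta_0 : vcoord beta 0 = 0)
    (toepA : toeplitz A) (A_neq0 : A != 0)
    (defA : A = Amx a alpha + a0 *: Imx _ n m)
    (toepB : toeplitz B) (B_neq0 : B != 0)
    (defB : B = Amx b beta + b0 *: Imx _ m l) :
  toeplitz (A *m B) <->
    (cond1 A alpha a0 \/
     exists lambda : hatC R[i],
       A_form A alpha a0 lambda /\ B_form k' B b beta b0 lambda).
Proof.
have le_lkS : (l <= k'.+1 * m)%N by rewrite -addn1.
rewrite defB in B_neq0; have t_neq0 := diagonals_neq0 m_gt0 lt_ml B_neq0.
rewrite defA defB [in X in X <-> _]Adiag_mx [in X in X <-> _]Adiag_mx.
apply: (iff_trans (toeplitz_mulP _ _ _ _ _)).
apply: (iff_trans (rank1_eqP (fun i : 'I_n => 0 < i)%N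
  (fun i => Adiag a alpha a0 (- i%:Z))
  (fun i => Adiag a alpha a0 (m%:Z - i%:Z)) t_neq0)).
split=> -[E1 | [[z|] [EA EB]]].
- by left; apply/cond1P.
- right; exists (Some z); split; first exact/A_form_finP.
  exact/(B_form_finP _ _ _ m_gt0 lt_ml le_lkS).
- right; exists None; split; first exact/A_form_infP.
  exact/(B_form_infP _ _ _ _ m_gt0 lt_ml).
- by left; apply/(cond1P a _ a0 n_gt0 le_nm).
- right; exists (Some z); split; first exact/(A_form_finP a _ a0 n_gt0 le_nm).
  exact/(B_form_finP _ _ _ m_gt0 lt_ml le_lkS).
- right; exists None; split; first exact/(A_form_infP a alpha a0 n_gt0 le_nm).
  exact/(B_form_infP k' b _ b0 m_gt0 lt_ml).
Qed.
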